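(* Let $A$ be a Banach algebra and let $B$ be a Banach $A$-bimodule with $\tilde Z^\ell_{A^{**}}(B^{**})=B^{**}$. Let $D:A\to B^*$ be a derivation. Then $D''(A^{**})B^{**}\subseteq A^*$, where $D'':A^{**}\to B^{***}$ is the second adjoint of $D$.
   Context: For a bounded bilinear map $m:X\times Y\to Z$ of normed spaces define $m^*:Z^*\times X\to Y^*$ by $\langle m^*(z',x),y\rangle=\langle z',m(x,y)\rangle$, $m^{**}=(m^* )^*:Y^{**}\times Z^*\to X^*$ and $m^{***}=(m^{**})^*:X^{**}\times Y^{**}\to Z^{**}$. $A^{**}$ has the first Arens product ($m^{***}$ for $m$ the product of $A$), and $B^{**}$ is a Banach $A^{**}$-bimodule with left and right actions $m^{***}$ for $m$ the left and right actions of $A$ on $B$, written by juxtaposition. $B^*$ is the dual $A$-bimodule: $\langle ab',b\rangle=\langle b',ba\rangle$, $\langle b'a,b\rangle=\langle b',ab\rangle$. A derivation $D:A\to B^*$ is a bounded linear map with $D(xy)=xD(y)+D(x)y$. For $b'''\in B^{***}$, $b''\in B^{**}$, the element $b'''b''\in A^{***}$ is defined by $\langle b'''b'',a''\rangle=\langle b''',b''a''\rangle$ ($a''\in A^{**}$). $A^*$ is identified with its canonical image in $A^{***}$, and $D''(A^{**})B^{**}$ is the set of all products $D''(a'')b''$. $\tilde Z^\ell_{A^{**}}(B^{**})$ is the set of $b''\in B^{**}$ such that $a''\mapsto b''a''$, $A^{**}\to B^{**}$, is weak*-to-weak continuous, i.e. from $\sigma(A^{**},A^* )$ to $\sigma(B^{**},B^{***})$.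 *)

(* Defs.v *)
From HB Require Import structures.
From mathcomp Require Import all_boot all_order all_algebra.
From mathcomp Require Import sesquilinear complex.
From mathcomp Require Import all_classical all_reals all_analysis.

Set Implicit Arguments.
Unset Strict Implicit.
Unset Printing Implicit Defensive.

Import Order.TTheory GRing.Theory Num.Theory.
Import numFieldNormedType.Exports.

Local Open Scope classical_set_scope.
Local Open Scope ring_scope.

(* Normed spaces are over the real or over the complex numbers. *)
Variant scalar_kind := RealScalars | ComplexScalars.

Definition scalar_field (R : realType) (k : scalar_kind) : numFieldType :=
  match k with RealScalars => R | ComplexScalars => R[i]%C end.

Lemma scalar_supremums (R : realType) (k : scalar_kind)
    (A : set (scalar_field R k)) :
  A `<=` [set x | 0 <= x] -> A !=set0 -> ubound A !=set0 ->
  supremums A !=set0.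
Proof.
case: k A => /= A A0 [a Aa] [u Au].
  exists (sup A); split; first by apply: ub_le_sup; exists u.
  by move=> v Av; apply: ge_sup => //; exists a.
have ReA x : A x -> x = (complex.Re x)%:C%C.
  by move=> /A0 /=; rewrite lecE => /andP[/eqP]; case: x => ? ? /= ->.
pose S : set R := (@complex.Re R) @` A.
have S0 : S !=set0 by exists (complex.Re a), a.
have leS (v : R[i]%C) : ubound A v -> ubound S (complex.Re v).
  by move=> Av _ [y Ay <-]; move: (Av _ Ay); rewrite lecE => /andP[].
exists (sup S)%:C%C; split.
  move=> x Ax; rewrite (ReA _ Ax) lecR; apply: ub_le_sup.
    by exists (complex.Re u); exact: leS.
  by exists x.
move=> v Av; have /= := Av _ Aa.
rewrite (ReA _ Aa) !lecE /= => /andP[-> _] /=.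
by apply: ge_sup => //; exact: leS.
Qed.

Section BoundedLinear.
Context {R : realType} {k : scalar_kind}.
Local Notation K := (scalar_field R k).
Context (X Y : normedModType K).

Definition bounded_linear_pred : pred (X -> Y) := fun f =>
  `[< linear f /\ exists M : K, forall x, `|f x| <= M * `|x| >].

Record bounded_linear := BoundedLinear {
  bounded_linear_fun :> X -> Y;
  _ : bounded_linear_pred bounded_linear_fun }.

HB.instance Definition _ := [isSub for bounded_linear_fun].
HB.instance Definition _ := [Choice of bounded_linear by <:].

Lemma bounded_linear_submod_closed : submod_closed bounded_linear_pred.
Proof.
split.
  apply/asboolP; split; first by move=> a x y; rewrite scaler0 addr0.
  by exists 0 => x; rewrite mul0r normr0.
move=> a f g /asboolP[fl [M fM]] /asboolP[gl [N gN]]; apply/asboolP; split.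
  move=> b x y; rewrite !fctE fl gl !scalerDr !scalerA [a * b]mulrC.
  by rewrite addrACA.
exists (`|a| * M + N) => x; rewrite !fctE (le_trans (ler_normD _ _))//.
by rewrite mulrDl lerD// normrZ -mulrA ler_wpM2l.
Qed.

HB.instance Definition _ :=
  GRing.isSubmodClosed.Build _ _ bounded_linear_pred
    bounded_linear_submod_closed.
HB.instance Definition _ := [SubChoice_isSubLmodule of bounded_linear by <:].

Definition opnorm (f : bounded_linear) : K :=
  supremum 0 [set `|f x| | x in [set x : X | `|x| <= 1]].

Lemma bounded_linearP (f : bounded_linear) : linear f.
Proof. by case: f => f /= /asboolP[]. Qed.

Lemma bounded_linear_bound (f : bounded_linear) :
  exists2 M : K, 0 <= M & forall x, `|f x| <= M * `|x|.
Proof.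
case: f => f /= /asboolP[_ [M fM]]; exists `|M| => // x.
have := fM x => /[dup] /(le_trans (normr_ge0 _)) M0.
by rewrite -{2}(normr_id x) -normrM (ger0_norm M0).
Qed.

Lemma bounded_linearZ (f : bounded_linear) a x : f (a *: x) = a *: f x.
Proof.
have f0 : f 0 = 0.
  have := bounded_linearP f 1 0 0; rewrite !scale1r addr0 => e.
  by apply: (@addrI _ (f 0)); rewrite -e addr0.
by rewrite -[a *: x]addr0 (bounded_linearP f) f0 addr0.
Qed.

Lemma opnorm_supremums (f : bounded_linear) :
  supremums [set `|f x| | x in [set x : X | `|x| <= 1]] !=set0.
Proof.
apply: scalar_supremums.
- by move=> _ [x _ <-] /=.
- by exists `|f 0|, 0 => //=; rewrite normr0 ler01.
- have [M M0 fM] := bounded_linear_bound f; exists M => _ [x /= x1 <-].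
  by rewrite (le_trans (fM x))// ler_piMr.
Qed.

Lemma opnorm_supremum (f : bounded_linear) :
  supremums [set `|f x| | x in [set x : X | `|x| <= 1]] (opnorm f).
Proof.
rewrite /opnorm /supremum; case: ifPn => [/eqP A0|_].
  suff : [set `|f x| | x in [set x : X | `|x| <= 1]] `|f 0| by rewrite A0.
  by exists 0 => //=; rewrite normr0 ler01.
by case: xgetP => // /(_ _ _); have [s As] := opnorm_supremums f => /(_ s).
Qed.

Lemma opnorm_ge0 (f : bounded_linear) : 0 <= opnorm f.
Proof.
have [+ _] := opnorm_supremum f => /(_ `|f 0|) => h.
by rewrite (le_trans (normr_ge0 (f 0)))// h//; exists 0; rewrite //= normr0.
Qed.

Lemma ler_opnorm (f : bounded_linear) x : `|f x| <= opnorm f * `|x|.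
Proof.
have [->|x0] := eqVneq x 0.
  have := bounded_linearZ f 0 0; rewrite !scale0r => ->.
  by rewrite !normr0 mulr0.
have xp : 0 < `|x| by rewrite normr_gt0.
rewrite -ler_pdivrMr// mulrC.
have [+ _] := opnorm_supremum f => /(_ (`|x|^-1 * `|f x|)); apply.
exists (`|x|^-1 *: x) => /=.
  by rewrite normrZ normfV normr_id mulVf ?gt_eqF.
by rewrite bounded_linearZ normrZ normfV normr_id.
Qed.

Lemma opnorm_le (f : bounded_linear) M :
  0 <= M -> (forall x, `|f x| <= M * `|x|) -> opnorm f <= M.
Proof.
move=> M0 fM; have [_ +] := opnorm_supremum f; apply=> _ [x /= x1 <-].
by rewrite (le_trans (fM x))// ler_piMr.
Qed.

Lemma opnormD (f g : bounded_linear) : opnorm (f + g) <= opnorm f + opnorm g.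
Proof.
apply: opnorm_le => [|x]; first by rewrite addr_ge0 ?opnorm_ge0.
rewrite mulrDl (le_trans (ler_normD _ _))//.
by rewrite lerD// ler_opnorm.
Qed.

Lemma opnormZ a (f : bounded_linear) : opnorm (a *: f) = `|a| * opnorm f.
Proof.
have le b (g : bounded_linear) : opnorm (b *: g) <= `|b| * opnorm g.
  apply: opnorm_le => [|x]; first by rewrite mulr_ge0 ?opnorm_ge0.
  rewrite -[X in `|X|]/(b *: g x) normrZ -mulrA ler_wpM2l//.
  exact: ler_opnorm.
apply/le_anti; rewrite le /=.
have [->|a0] := eqVneq a 0; first by rewrite normr0 mul0r opnorm_ge0.
rewrite -ler_pdivlMl ?normr_gt0// -normfV.
by rewrite -{1}[f](scalerK a0) le.
Qed.

Lemma opnorm0_eq0 (f : bounded_linear) : opnorm f = 0 -> f = 0.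
Proof.
move=> f0; apply/val_inj/funext => x; apply/normr0_eq0/le_anti.
by rewrite normr_ge0 andbT; have := ler_opnorm f x; rewrite f0 mul0r.
Qed.

HB.instance Definition _ :=
  Lmodule_isNormed.Build K bounded_linear opnormD opnormZ opnorm0_eq0.

Lemma opnormE (f : bounded_linear) : `|f| = opnorm f.
Proof. by []. Qed.

Lemma ler_bounded_linear (f : bounded_linear) x : `|f x| <= `|f| * `|x|.
Proof. exact: ler_opnorm. Qed.

End BoundedLinear.
Arguments bounded_linear {R k} X Y.

Notation dual X := (bounded_linear X (scalar_field _ _)^o).

Section BoundedBilinear.
Context {R : realType} {k : scalar_kind}.
Local Notation K := (scalar_field R k).

Record bounded_bilinear (X Y Z : normedModType K) := BoundedBilinear {
  bounded_bilinear_fun :> X -> Y -> Z;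
  bounded_bilinearP : bilinear_for *:%R *:%R bounded_bilinear_fun;
  bounded_bilinear_bound : exists M : K,
    forall x y, `|bounded_bilinear_fun x y| <= M * (`|x| * `|y|) }.

Lemma bounded_bilinear_bound0 (X Y Z : normedModType K)
    (m : bounded_bilinear X Y Z) :
  exists2 M : K, 0 <= M & forall x y, `|m x y| <= M * (`|x| * `|y|).
Proof.
have [M mM] := bounded_bilinear_bound m; exists `|M| => // x y.
have := mM x y => /[dup] /(le_trans (normr_ge0 _)) M0.
rewrite -(ger0_norm M0) normrM.
by rewrite (@ger0_norm _ (`|x| * `|y|)) ?mulr_ge0.
Qed.

Section ArensAdjoint.
Context (X Y Z : normedModType K) (m : bounded_bilinear X Y Z).

Lemma arens_adjoint_subproof (z' : dual Z) (x : X) :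
  bounded_linear_pred (fun y : Y => z' (m x y) : K^o).
Proof.
apply/asboolP; split.
  by move=> a u v; rewrite (bounded_bilinearP m).2 bounded_linearP.
have [M M0 mM] := bounded_bilinear_bound0 m.
exists (`|z'| * (M * `|x|)) => y; rewrite (le_trans (ler_bounded_linear _ _))//.
by rewrite -!mulrA ler_wpM2l.
Qed.

Definition arens_adjoint_fun (z' : dual Z) (x : X) : dual Y :=
  BoundedLinear (arens_adjoint_subproof z' x).

Lemma arens_adjoint_bilinear : bilinear_for *:%R *:%R arens_adjoint_fun.
Proof.
split=> [x a f g|z' a u v]; apply/val_inj/funext => y //=.
by rewrite (bounded_bilinearP m).1 bounded_linearP.
Qed.

Lemma arens_adjoint_bound : exists M : K,
  forall z' x, `|arens_adjoint_fun z' x| <= M * (`|z'| * `|x|).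
Proof.
have [M M0 mM] := bounded_bilinear_bound0 m; exists M => z' x.
apply: opnorm_le => [|y]; first by rewrite !mulr_ge0.
rewrite (le_trans (ler_bounded_linear z' _))//.
by rewrite -!mulrA [leRHS]mulrCA ler_wpM2l.
Qed.

(* The map m^* : Z^* x X -> Y^*, <m^*(z', x), y> = <z', m(x, y)>. *)
Definition arens_adjoint : bounded_bilinear (dual Z) X (dual Y) :=
  BoundedBilinear arens_adjoint_bilinear arens_adjoint_bound.

End ArensAdjoint.

(* The third adjoint m^*** : X^** x Y^** -> Z^**. *)
Definition arens_ext (X Y Z : normedModType K) (m : bounded_bilinear X Y Z) :
    bounded_bilinear (dual (dual X)) (dual (dual Y)) (dual (dual Z)) :=
  arens_adjoint (arens_adjoint (arens_adjoint m)).

Section Transpose.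
Context (X Y Z : normedModType K) (m : bounded_bilinear X Y Z).

Lemma transpose_bilinear : bilinear_for *:%R *:%R (fun y x => m x y).
Proof.
by split=> [x|y] a u v; rewrite ?(bounded_bilinearP m).1
  ?(bounded_bilinearP m).2.
Qed.

Lemma transpose_bound : exists M : K,
  forall y x, `|m x y| <= M * (`|y| * `|x|).
Proof.
have [M mM] := bounded_bilinear_bound m.
by exists M => y x; rewrite [`|y| * _]mulrC.
Qed.

Definition bilinear_transpose : bounded_bilinear Y X Z :=
  BoundedBilinear transpose_bilinear transpose_bound.

End Transpose.

Section Adjoint.
Context (X Y : normedModType K) (T : bounded_linear X Y).

Lemma adjoint_fun_subproof (y' : dual Y) :
  bounded_linear_pred (fun x : X => y' (T x) : K^o).
Proof.
apply/asboolP; split; first by move=> a u v; rewrite !bounded_linearP.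
exists (`|y'| * `|T|) => x; rewrite (le_trans (ler_bounded_linear _ _))//.
by rewrite -mulrA ler_wpM2l// ler_bounded_linear.
Qed.

Definition adjoint_fun (y' : dual Y) : dual X :=
  BoundedLinear (adjoint_fun_subproof y').

Lemma adjoint_subproof : bounded_linear_pred adjoint_fun.
Proof.
apply/asboolP; split; first by move=> a f g; apply/val_inj/funext.
exists `|T| => y'; apply: opnorm_le => [|x]; first by rewrite mulr_ge0.
rewrite (le_trans (ler_bounded_linear y' _))// mulrAC [leRHS]mulrC ler_wpM2l//.
exact: ler_bounded_linear.
Qed.

Definition adjoint : bounded_linear (dual Y) (dual X) :=
  BoundedLinear adjoint_subproof.

End Adjoint.

Section CanonicalEmbedding.
Context (X : normedModType K).

Lemma bidual_embed_subproof (x : X) :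
  bounded_linear_pred (fun f : dual X => f x : K^o).
Proof.
apply/asboolP; split=> //; exists `|x| => f.
by rewrite mulrC ler_bounded_linear.
Qed.

Definition bidual_embed (x : X) : dual (dual X) :=
  BoundedLinear (bidual_embed_subproof x).

End CanonicalEmbedding.

(* sigma(X, X^* ) and sigma(X^*, X): the initial topologies for evaluation
   into a product of copies of the scalar field. *)
Definition weak (X : normedModType K) : topologicalType :=
  initial_topology ((fun x f => f x) : X -> {ptws dual X -> K^o}).

Definition weak_star (X : normedModType K) : topologicalType :=
  initial_topology ((fun f x => f x) : dual X -> {ptws X -> K^o}).

(* A Banach algebra need not be unital. *)
Definition banach_algebra (A : completeNormedModType K)
    (mulA : bounded_bilinear A A A) : Prop :=
  associative mulA /\ forall a b, `|mulA a b| <= `|a| * `|b|.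

Section BanachBimodule.
Context (A B : completeNormedModType K) (mulA : bounded_bilinear A A A)
  (lact : bounded_bilinear A B B) (ract : bounded_bilinear B A B).

Definition banach_bimodule : Prop :=
  [/\ forall a a' b, lact (mulA a a') b = lact a (lact a' b),
      forall b a a', ract b (mulA a a') = ract (ract b a) a' &
      forall a b a', ract (lact a b) a' = lact a (ract b a')].

(* The dual bimodule: <ab', b> = <b', ba> and <b'a, b> = <b', ab>. *)
Definition dual_lact (a : A) (b' : dual B) : dual B :=
  arens_adjoint (bilinear_transpose ract) b' a.

Definition dual_ract (b' : dual B) (a : A) : dual B :=
  arens_adjoint lact b' a.

Definition derivation (D : bounded_linear A (dual B)) : Prop :=
  forall x y, D (mulA x y) = dual_lact x (D y) + dual_ract (D x) y.

(* The set of b'' such that a'' |-> b''a'' is weak*-to-weak continuous. *)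
Definition wsw_left_center : set (dual (dual B)) :=
  [set b'' | continuous
    ((fun a'' => arens_ext ract b'' a'')
       : weak_star (dual A) -> weak (dual (dual B)))].

(* <b'''b'', a''> = <b''', b''a''>. *)
Definition tridual_ract (b''' : dual (dual (dual B))) (b'' : dual (dual B)) :
    dual (dual (dual A)) :=
  arens_adjoint (arens_ext ract) b''' b''.

End BanachBimodule.

End BoundedBilinear.

(* Main.v *)
Require Import Defs.
From HB Require Import structures.
From mathcomp Require Import all_boot all_order all_algebra.
From mathcomp Require Import all_classical all_reals all_analysis.

Import Order.TTheory GRing.Theory Num.Theory.
Import numFieldNormedType.Exports.

Local Open Scope classical_set_scope.
Local Open Scope ring_scope.

(** For [b'''] in [B^***] and [b''] in [B^**], the functional [b'''b''] on
    [A^**] is the composite of [a'' |-> b''a''] and [b''']. The first map is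
    weak*-to-weak continuous by the assumption on the left centre, and [b'''] is
    weakly continuous ([weak_eval_continuous]), so [b'''b''] is weak*-continuous.
    The weak*-continuous linear functionals on a dual space [X^*] are exactly the
    evaluations at points of [X] ([weak_star_continuous_eval]); with [X = A^*]
    this says that [b'''b''] lies in [A^*]. The inclusion is the case
    [b''' = D''(a'')].

    That a weak*-continuous functional [F] is an evaluation is shown in two
    steps. The annihilators of finite subsets of [X] form a filter base that
    converges weak* to [0], so [F] is bounded by [1] on one of them, which is a
    linear subspace, and hence vanishes there. A functional that vanishes on the
    common kernel of finitely many evaluations is a linear combination of them
    ([annihilator_eval]). *)

Lemma cvg_to_initial {S : choiceType} {T : topologicalType} (f : S -> T)
    (F : set_system S) (s : S) :
  Filter F -> f @ F --> f s -> F --> (s : initial_topology f).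
Proof.
move=> FF Ffs A /= [_ [[V oV <-] Vs VA]].
apply: (filterS VA); exact/Ffs/open_nbhs_nbhs.
Qed.

Lemma cvg_to_ptws {U : eqType} {V : topologicalType}
    (F : set_system {ptws U -> V}) (f : {ptws U -> V}) :
  Filter F -> (forall u, (fun g : {ptws U -> V} => g u) @ F --> f u) -> F --> f.
Proof.
move=> FF Ff; apply/cvg_sup => u; exact: (cvg_to_initial (fun g => g u) F f FF (Ff u)).
Qed.

Section WeakStarContinuousFunctional.
Context {R : realType} {k : scalar_kind}.
Local Notation K := (scalar_field R k).
Context {X : normedModType K}.

Definition annihilator (s : seq X) : set (dual X) :=
  [set phi | forall x, x \in s -> phi x = 0].

(** Strictly finer than the weak* neighbourhood filter of [0] in general: vanishing
    on a finite set replaces being small there, so no epsilon enters, and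
    convergence to [0] still lets continuity be applied. *)
Definition annihilator_filter : set_system (dual X) :=
  filter_from setT annihilator.

Lemma annihilator_filter_filter : Filter annihilator_filter.
Proof.
apply: filter_from_filter; first by exists [::].
move=> s t _ _; exists (s ++ t) => // phi phi0; split=> x xs;
  by apply: phi0; rewrite mem_cat xs ?orbT.
Qed.

Lemma annihilator_filter_cvg0 :
  annihilator_filter --> ((0 : dual X) : weak_star X).
Proof.
have FF := annihilator_filter_filter.
apply: cvg_to_initial; apply: cvg_to_ptws => x U /nbhs_singleton U0.
by exists [:: x] => // phi /(_ x (mem_head _ _)) phix0; rewrite /= phix0.
Qed.

(** Induction on [s]. If evaluation at the head [x] does not already vanish on
    the annihilator of the tail, pick [phi] there with [phi x != 0]: subtracting
    the multiple of evaluation at [x] that agrees with [F] at [phi] gives a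
    functional that vanishes on the annihilator of the tail. *)
Lemma annihilator_eval (s : seq X) (F : dual (dual X)) :
  annihilator s `<=` [set phi | F phi = 0] -> exists x, F = bidual_embed x.
Proof.
elim: s F => [|x s IHs] F F0.
  exists 0; apply/val_inj/funext => phi /=; rewrite (F0 phi)//.
  by rewrite -(scale0r (0 : X)) bounded_linearZ scale0r.
have [allx|/existsNP[phi /not_implyP[phis /eqP phix]]] :=
  pselect (forall phi, annihilator s phi -> phi x = 0).
  apply: IHs => phi phis; apply: F0 => y; rewrite inE => /orP[/eqP ->|].
    exact: allx.
  exact: phis.
pose c : K := F phi / phi x.
have [|y Fy] := IHs (F - c *: bidual_embed x).
  move=> psi psis /=.
  (* Correcting [psi] by a multiple of [phi] makes it vanish at [x] as well. *)
  have : F (- (psi x / phi x) *: phi + psi) = 0.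
    apply: F0 => y /=; rewrite inE => /orP[/eqP ->|ys] /=.
      rewrite -[LHS]/(- (psi x / phi x) * phi x + psi x).
      by rewrite mulNr divfK ?addNr.
    rewrite -[LHS]/(- (psi x / phi x) * phi y + psi y).
    by rewrite (phis y ys) (psis y ys) mulr0 addr0.
  rewrite bounded_linearP => e.
  rewrite -[LHS]/(F psi - c * psi x) -e addrC; congr (_ + _).
  rewrite -[RHS]/(- (psi x / phi x) * F phi) mulNr; congr (- _).
  by rewrite /c mulrAC [F phi * _]mulrC mulrAC.
exists (c *: x + y); rewrite -[LHS](subrK (c *: bidual_embed x)) Fy.
apply/val_inj/funext => psi /=.
by rewrite bounded_linearP addrC.
Qed.

Lemma weak_star_continuous_eval (F : dual (dual X)) :
  continuous (F : weak_star X -> K^o) -> exists x, F = bidual_embed x.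
Proof.
move=> Fc; have FF := annihilator_filter_filter.
have F0 : F 0 = 0 by rewrite -(scale0r (0 : dual X)) bounded_linearZ scale0r.
have : F @ annihilator_filter --> (0 : K^o).
  rewrite -F0; apply: (cvg_comp _ _ annihilator_filter_cvg0); exact: Fc.
move=> /(_ _ (nbhsx_ballx (0 : K^o) 1 ltr01)) [s _ sF1].
(* If [F phi != 0], then [phi / F phi] is in the annihilator and [F] is [1] there,
   which contradicts the strict bound [sF1]. *)
apply: (@annihilator_eval s) => phi phis /=; apply/eqP/negPn/negP => Fphi.
have /sF1 : annihilator s ((F phi)^-1 *: phi).
  move=> x xs; rewrite -[LHS]/((F phi)^-1 * phi x).
  by rewrite phis // mulr0.
rewrite /= bounded_linearZ -ball_normE /= sub0r normrN.
by rewrite -[X in `|X|]/((F phi)^-1 * F phi) mulVf // normr1 ltxx.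
Qed.

End WeakStarContinuousFunctional.

Lemma weak_eval_continuous {R : realType} {k : scalar_kind}
    {X : normedModType (scalar_field R k)} (f : dual X) :
  continuous (f : weak X -> (scalar_field R k)^o).
Proof.
move=> x; apply: (@continuous_comp _ _ _
  ((fun x f => f x) : weak X -> {ptws dual X -> (scalar_field R k)^o})
  (@^~ f)); first exact: initial_continuous.
exact: (@proj_continuous _ (fun=> (scalar_field R k)^o) f).
Qed.

Theorem mainTheorem8 (R : realType) (k : scalar_kind)
  (A B : completeNormedModType (scalar_field R k))
  (mulA : bounded_bilinear A A A)
  (lact : bounded_bilinear A B B) (ract : bounded_bilinear B A B)
  (D : bounded_linear A (dual B)) :
  banach_algebra mulA ->
  banach_bimodule mulA lact ract ->
  wsw_left_center ract = [set: dual (dual B)] ->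
  derivation mulA lact ract D ->
  [set tridual_ract ract (adjoint (adjoint D) a'') b''
    | a'' in [set: dual (dual A)] & b'' in [set: dual (dual B)]]
  `<=` range (@bidual_embed R k (dual A)).
Proof.
move=> _ _ centerT _ _ [a'' _ [b'' _ <-]].
have b''_center : wsw_left_center ract b'' by rewrite centerT.
have [a' ->] := @weak_star_continuous_eval _ _ (dual A)
  (tridual_ract ract (adjoint (adjoint D) a'') b'')
  (fun c => continuous_comp (b''_center c)
    (@weak_eval_continuous _ _ _ (adjoint (adjoint D) a'') _)).
by exists a'.
Qed.
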